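(* Let $G$ be a finite nilpotent group. Then $\Gamma^*(G)$ has a universal vertex if and only if $G$ is isomorphic to one of the following groups: (1) $\mathbb{Z}_{p^rq}$, where $p,q$ are distinct primes and $r\geq 1$; (2) $\mathbb{Z}_{p}\rtimes \mathbb{Z}_{q}$, where $p,q$ are distinct primes and $q\mid p-1$; (3) $\mathbb{Z}_{p^{n-1}}\times \mathbb{Z}_{p}$, where $p$ is a prime and $n\geq 2$; (4) $M_{p^n}=\langle a,b : a^{p^{n-1}}=b^p=e,\ b^{-1}ab=a^{1+p^{n-2}} \rangle$, where $p$ is a prime and $n\geq 3$ (with $n\geq 4$ if $p=2$); (5) $D_{2^{n}}=\langle a,b : a^{2^{n-1}}=b^2=e,\ bab=a^{-1} \rangle$, where $n\geq 3$; (6) $Q_{2^{n}}=\langle a,b : a^{2^{n-1}}=e,\ b^2=a^{2^{n-2}},\ b^{-1}ab=a^{-1} \rangle$, where $n\geq 3$; (7) $SD_{2^{n}}=\langle a,b : a^{2^{n-1}}=b^2=e,\ bab=a^{-1+2^{n-2}}\rangle$, where $n\geq 4$.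
   Context: For a group $G$, the co-maximal subgroup graph $\Gamma(G)$ is the simple undirected graph whose vertices are the non-trivial proper subgroups of $G$, two distinct vertices $H,K$ being adjacent if and only if $HK=G$, where $HK=\{hk : h\in H, k\in K\}$. The deleted co-maximal subgroup graph $\Gamma^*(G)$ is the graph obtained by removing all isolated vertices from $\Gamma(G)$. A universal vertex is a vertex adjacent to all other vertices of the graph (the graph with no vertices has none). $\mathbb{Z}_n$ denotes the cyclic group of order $n$. The assertion concerns only nilpotent $G$; the list is a list of isomorphism types, and a listed group that is not nilpotent is simply not realised by any such $G$. *)

(* Defs.v *)
From mathcomp Require Import all_boot all_fingroup all_algebra all_solvable.

Set Implicit Arguments.
Unset Strict Implicit.
Unset Printing Implicit Defensive.

Local Open Scope group_scope.

Record sgraph (T : finType) := SGraph {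
  vertices : {set T};
  adj : rel T;
  adj_sym : symmetric adj;
  adj_irr : irreflexive adj;
  adj_vertex : forall x y, adj x y -> x \in vertices
}.

Section Sgraph.

Variables (T : finType) (X : sgraph T).

Definition isolated (x : T) : bool := [forall y in vertices X, ~~ adj X x y].

Definition deleted_vertices : {set T} :=
  [set x in vertices X | ~~ isolated x].

Definition deleted_adj : rel T :=
  [rel x y | [&& x \in deleted_vertices, y \in deleted_vertices & adj X x y]].

Lemma deleted_adj_sym : symmetric deleted_adj.
Proof. by move=> x y; rewrite /deleted_adj /= adj_sym andbCA. Qed.

Lemma deleted_adj_irr : irreflexive deleted_adj.
Proof. by move=> x; rewrite /deleted_adj /= adj_irr !andbF. Qed.

Lemma deleted_adj_vertex x y : deleted_adj x y -> x \in deleted_vertices.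
Proof. by case/and3P. Qed.

Definition delete_isolated : sgraph T :=
  SGraph deleted_adj_sym deleted_adj_irr deleted_adj_vertex.

Definition universal_vertex (x : T) : Prop :=
  x \in vertices X /\
  forall y, y \in vertices X -> y != x -> adj X x y.

End Sgraph.

Section Comaximal.

Variables (gT : finGroupType) (G : {group gT}).

Definition comax_vertices : {set {group gT}} :=
  [set H : {group gT} | (H \proper G) && (H :!=: 1)].

Definition comax_adj : rel {group gT} :=
  [rel H K | [&& H \in comax_vertices, K \in comax_vertices,
                 H != K & H * K == G :> {set gT}]].

Lemma comax_adj_sym : symmetric comax_adj.
Proof.
have mulGC (H K : {group gT}) : H * K = G -> K * H = G.
  move=> defG; suffices /comm_group_setP <- : group_set (H * K) by [].
  by rewrite defG groupP.
move=> H K; rewrite /comax_adj /= andbCA (eq_sym H); congr [&& _, _, _ & _].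
by apply/eqP/eqP; apply: mulGC.
Qed.

Lemma comax_adj_irr : irreflexive comax_adj.
Proof. by move=> H; rewrite /comax_adj /= eqxx !andbF. Qed.

Lemma comax_adj_vertex H K : comax_adj H K -> H \in comax_vertices.
Proof. by case/and4P. Qed.

Definition comax_graph : sgraph {group gT} :=
  SGraph comax_adj_sym comax_adj_irr comax_adj_vertex.

Definition deleted_comax_graph : sgraph {group gT} :=
  delete_isolated comax_graph.

End Comaximal.

(* The action of Zq on Zp is required to be non-trivial: for primes p and q
   with q %| p.-1 this determines a single isomorphism type. *)
Definition is_sdprod_Zp_Zq (p q : nat) (gT : finGroupType) (G : {group gT}) :
    Prop :=
  exists A B : {group gT},
    [/\ A ><| B = G, A \isog Zp p, B \isog Zp q & ~~ (B \subset 'C(A))].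

(* Main.v *)
Require Import Defs.
From mathcomp Require Import all_boot all_fingroup all_algebra all_solvable.

(** In a nilpotent group every maximal subgroup is normal of prime index, so a
    proper subgroup is a vertex of the deleted graph exactly when it is not
    contained in ['Phi(G)] ([deleted_comax_vertexE]). A universal vertex [H] is
    comparable with no other vertex. Hence [H] is maximal, and it is generated
    by each of its elements outside ['Phi(G)], which makes it a cyclic group of
    prime power order. Conversely, a cyclic maximal subgroup of prime power
    order that is not in ['Phi(G)] is universal ([universal_vertexP]).

    Let [H] be a [p]-group, of prime index [q]. If [q] differs from [p], then
    [G] is the product of its Sylow subgroups [H] and ['O_q(G)], so it is cyclic
    of order [p ^ r * q]; conversely the Sylow [p]-subgroup of such a group is
    universal ([universal_vertex_pgroup_or_cyclic],
    [universal_vertex_cyclic_pq]).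
    If [q = p], the condition becomes that [G] is a noncyclic [p]-group with a
    cyclic subgroup of index [p] ([universal_vertex_pgroupP]). The abelian
    groups of this kind are the products of a nontrivial cyclic [p]-group and a
    group of order [p], because the cyclic subgroup of index [p] splits off; the
    nonabelian ones are the modular, dihedral, quaternion and semidihedral
    groups ([near_cyclic_classP]). The nontrivial semidirect products in the
    list are not nilpotent ([nilpotent_not_sdprod_Zp_Zq]). *)

Set Implicit Arguments.
Unset Strict Implicit.

Local Open Scope group_scope.

(** * Maximal subgroups and the Frattini subgroup *)

(** Normalizers grow in a nilpotent group, so the normalizer of a maximal
    subgroup is the whole group. *)
Lemma nilpotent_maximal_normal (gT : finGroupType) (G M : {group gT}) :
  nilpotent G -> maximal M G -> M <| G.
Proof.
move=> nilG maxM; have [prM _] := maxgroupP maxM.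
have [sMG _] := andP prM.
have := nilpotent_proper_norm nilG prM; rewrite /normal sMG /= => ltMN.
have [_ /(_ 'N_G(M)%G)] := maxgroupP maxM.
rewrite /= subsetI sMG normG => maxN.
apply: contraT => nNM; have prN: 'N_G(M) \proper G.
  by rewrite properE subsetIl subsetI subxx.
by rewrite maxN ?properxx in ltMN.
Qed.

(** The quotient by a maximal subgroup is simple and solvable. *)
Lemma nilpotent_maximal_index (gT : finGroupType) (G M : {group gT}) :
  nilpotent G -> maximal M G -> prime #|G : M|.
Proof.
move=> nilG maxM; have nsMG := nilpotent_maximal_normal nilG maxM.
rewrite -card_quotient ?normal_norm //.
apply: simple_sol_prime; first by rewrite quotient_sol ?nilpotent_sol.
rewrite quotient_simple //; apply/maxgroupP.
have [prM maxM1] := maxgroupP maxM; split=> [|K /andP[prK _]].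
  by rewrite prM normal_norm.
exact: maxM1.
Qed.

(** A maximal subgroup [M] of [G] missing part of ['Phi(H)] would give
    [G = 'Phi(H) * M], hence [H = 'Phi(H) * (M :&: H)] by Dedekind's law; as
    ['Phi(H)] consists of non-generators of [H], this forces [H \subset M]. *)
Lemma Phi_normalS (gT : finGroupType) (G H : {group gT}) :
  H <| G -> 'Phi(H) \subset 'Phi(G).
Proof.
move=> nsHG; have [sHG _] := andP nsHG; have sPH := Phi_sub H.
have nsPG: 'Phi(H) <| G := char_normal_trans (Phi_char H) nsHG.
apply/bigcapsP=> M /predU1P[-> | maxM]; first exact: normal_sub.
have [/andP[sMG _] maxM1] := maxgroupP maxM.
have defMP: 'Phi(H) <*> M = 'Phi(H) * M.
  by rewrite norm_joinEr // (subset_trans sMG) ?normal_norm.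
have sPMG: 'Phi(H) <*> M \subset G by rewrite join_subG normal_sub.
have [defG | prPM] := eqVproper sPMG; last first.
  by rewrite -(maxM1 _ prPM) ?joing_subl ?joing_subr.
suffices defH: <<M :&: H>> = H.
  by rewrite (subset_trans sPH) // -defH gen_subG subsetIl.
apply: Phi_nongen; apply/eqP; rewrite eqEsubset join_subG sPH subsetIr /=.
have sMul: 'Phi(H) * (M :&: H) \subset 'Phi(H) <*> (M :&: H).
  by rewrite mul_subG ?joing_subl ?joing_subr.
by apply: subset_trans sMul; rewrite group_modl // -defMP defG subsetI sHG /=.
Qed.

(** All maximal subgroups of [H] have index [p], and a cyclic group has at most
    one subgroup of a given index: a maximal subgroup containing [K] is the only
    one. *)
Lemma proper_sub_Phi_cyclic_pgroup (gT : finGroupType) (p : nat)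
    (H K : {group gT}) :
  p.-group H -> cyclic H -> K \proper H -> K \subset 'Phi(H).
Proof.
move=> pH cycH prK; have [sKH _] := andP prK.
have [defK | [M maxM sKM]] := maximal_exists sKH.
  by rewrite defK properxx in prK.
apply/bigcapsP=> N /predU1P[-> // | maxN].
suffices ->: N :=: M by [].
have sub (L : {group gT}): maximal L H -> L \subset H.
  by move/maxgroupp/proper_sub.
apply/eqP; rewrite (eq_subG_cyclic cycH) ?sub //.
have := Lagrange (sub _ maxN); rewrite -(Lagrange (sub _ maxM)).
rewrite !(p_maximal_index pH) //; move/eqP; rewrite eqn_pmul2r //.
by rewrite -(p_maximal_index pH maxM) indexg_gt0.
Qed.

(** * Universal vertices of the deleted co-maximal subgroup graph *)

(** A subgroup of ['Phi(G)] never helps to generate [G], so it is isolated.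
    Any other proper subgroup escapes some maximal [M], and [H * M = G] because
    [M] is normal. *)
Lemma deleted_comax_vertexE (gT : finGroupType) (G H : {group gT}) :
  nilpotent G ->
  (H \in vertices (deleted_comax_graph G))
    = (H \proper G) && ~~ (H \subset 'Phi(G)).
Proof.
move=> nilG; apply/idP/andP=> [|[prH nPhiH]].
  rewrite inE => /andP[]; rewrite inE => /andP[prH _].
  rewrite negb_forall_in => /exists_inP[K]; rewrite negbK inE => /andP[prK _].
  case/and4P=> _ _ _ /eqP defG; split=> //; apply: contraL (prK) => sHPhi.
  rewrite -(genGid K) (@Phi_nongen _ G K) ?properxx //; apply/eqP.
  rewrite eqEsubset join_subG Phi_sub (proper_sub prK) /= -{1}defG.
  by rewrite mul_subG ?joing_subr // (subset_trans sHPhi) ?joing_subl.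
have ntH: H :!=: 1 by apply: contraNneq nPhiH => ->; apply: sub1G.
have [M maxM nsHM]: exists2 M : {group gT}, maximal M G & ~~ (H \subset M).
  apply/exists_inP; apply: contraR nPhiH; rewrite negb_exists_in.
  move/forall_inP=> sH.
  apply/bigcapsP=> M /predU1P[-> | /sH]; first exact: proper_sub.
  by rewrite negbK.
have defG: H * M = G.
  have nsM := nilpotent_maximal_normal nilG maxM.
  rewrite (normC (subset_trans (proper_sub prH) (normal_norm nsM))).
  exact: mulg_normal_maximal (proper_sub prH) _.
have prM := maxgroupp maxM.
have ntM: M :!=: 1.
  by apply: contraTneq prH => M1; rewrite -defG M1 mulg1 properxx.
rewrite inE inE prH ntH negb_forall_in; apply/exists_inP; exists M.
  by rewrite inE prM ntM.
rewrite negbK /= /comax_adj /= !inE prH ntH prM ntM defG eqxx andbT.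
by rewrite !andTb andbT; apply: contraNneq nsHM => ->.
Qed.

(** If [H] is universal then no other vertex [K] is comparable with [H], as
    [H * K] would be the larger of the two. Going up, this makes [H] maximal.
    Going down, each [x] in [H] outside ['Phi(G)] generates [H]; applied to the
    [p]-part and the [p']-part of such an [x], it shows that [H] is a [p]-group.
    Conversely, the proper subgroups of such an [H] lie in
    ['Phi(H) \subset 'Phi(G)], so every other vertex escapes the normal
    maximal subgroup [H]. *)
Lemma universal_vertexP (gT : finGroupType) (G H : {group gT}) :
  nilpotent G ->
  universal_vertex (deleted_comax_graph G) H
  <-> exists p, [/\ prime p, p.-group H, cyclic H, maximal H G
                   & ~~ (H \subset 'Phi(G))].
Proof.
move=> nilG; split=> [[] | [p [p_pr pH cycH maxH nPhiH]]].
  rewrite deleted_comax_vertexE // => /andP[prH nPhiH] univH.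
  have sHG := proper_sub prH.
  have mulH (K : {group gT}) :
      K \proper G -> ~~ (K \subset 'Phi(G)) -> K != H -> H * K = G.
    move=> prK nPhiK neqKH; have := univH K.
    rewrite deleted_comax_vertexE // prK nPhiK => /(_ isT neqKH).
    by case/and3P=> _ _ /and4P[_ _ _ /eqP].
  have genH x: x \in H -> x \notin 'Phi(G) -> H :=: <[x]>.
    move=> Hx nPhix; have sxH: <[x]> \subset H by rewrite cycle_subG.
    apply/eqP; apply: contraTT (prH) => neqH.
    rewrite -(mulH <[x]>%G) ?cycle_subG //.
    + by rewrite mulGSid ?properxx.
    + exact: sub_proper_trans prH.
    by rewrite eq_sym -val_eqE.
  have ntH: H :!=: 1 by apply: contraNneq nPhiH => ->; apply: sub1G.
  have [x Hx nPhix] := subsetPn nPhiH.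
  have p_pr: prime (pdiv #|H|) by rewrite pdiv_prime ?cardG_gt1.
  move: (pdiv _) p_pr (pdiv_dvd #|H|) => p p_pr p_dvd.
  exists p; split=> //; last 1 [idtac].
  - have [Phixp | nPhixp] := boolP (x.`_p \in 'Phi(G)); last first.
      by rewrite (genH _ (groupX _ Hx) nPhixp); apply: p_elt_constt.
    have nPhixp': x.`_p^' \notin 'Phi(G).
      by apply: contra nPhix => Phixp'; rewrite -(consttC p x) groupM.
    have: p^'.-group H.
      by rewrite (genH _ (groupX _ Hx) nPhixp'); apply: p_elt_constt.
    by move/(pnat_dvd p_dvd); rewrite pnatE // inE /= inE eqxx.
  - by rewrite (genH x) ?cycle_cyclic.
  have [defH | [M maxM sHM]] := maximal_exists sHG.
    by rewrite defH properxx in prH.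
  have [-> // | neqMH] := eqVneq H M; have prM := maxgroupp maxM.
  case/idPn: (prM); rewrite -(mulH M) ?mulSGid ?properxx // 1?eq_sym //.
  by apply: contra nPhiH; apply: subset_trans.
have prH := maxgroupp maxH; have nsHG := nilpotent_maximal_normal nilG maxH.
have VH: H \in vertices (deleted_comax_graph G).
  by rewrite deleted_comax_vertexE // prH.
split=> // K VK neqKH.
have /andP[prK nPhiK]: (K \proper G) && ~~ (K \subset 'Phi(G)).
  by rewrite -deleted_comax_vertexE.
have nsKH: ~~ (K \subset H).
  apply: contra nPhiK => sKH; apply: subset_trans (Phi_normalS nsHG).
  apply: proper_sub_Phi_cyclic_pgroup pH cycH _.
  by rewrite properEneq sKH andbT.
have defG := mulg_normal_maximal nsHG maxH (proper_sub prK) nsKH.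
apply/and3P; split=> //; apply/and4P; split; last by rewrite defG.
- by case/setIdP: VH.
- by case/setIdP: VK.
by rewrite eq_sym.
Qed.

(** * Presentations of the extremal groups *)

(** Groups sharing a presentation are homomorphic images of one another, hence
    isomorphic. *)
Lemma isoGrp_isog (gT rT : finGroupType) (G : {group gT}) (K : {group rT}) p :
  K \isog Grp p -> (G \isog K) <-> (G \isog Grp p).
Proof.
move=> presK; split=> [isoGK | presG]; first exact: isoGrp_trans isoGK presK.
by rewrite isogEhom presK -presG homg_refl presG -presK homg_refl.
Qed.

Lemma invg_sqr1 (gT : finGroupType) (b : gT) : b ^+ 2 = 1 -> b^-1 = b.
Proof. by move=> b2; apply/eqP; rewrite eq_invg_mul -[b * b]/(b ^+ 2) b2. Qed.

(** In the dihedral and semidihedral groups [b] is an involution, so that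
    [b * a * b] is the conjugate [a ^ b]. *)
Lemma Grp_2dihedral_mul n : (n > 1)%N ->
  'D_(2 ^ n) \isog Grp (a : b : a ^+ (2 ^ (n - 1))%N, b ^+ 2, b * a * b = a^-1).
Proof.
move=> n_gt1 rT K; rewrite Grp_2dihedral // subn1.
apply: eq_existsb => -[a b] /=; rewrite !xpair_eqE; congr (_ && _).
apply: andb_id2l => _; apply: andb_id2l => /eqP/invg_sqr1 b_inv.
by rewrite conjgE b_inv mulgA.
Qed.

Lemma Grp_semidihedral_mul n : (n > 3)%N ->
  'SD_(2 ^ n) \isog Grp (a : b : a ^+ (2 ^ (n - 1))%N, b ^+ 2,
                                 b * a * b = a ^+ (2 ^ (n - 2) - 1)%N).
Proof.
move=> n_gt3 rT K; rewrite Grp_semidihedral // subn1 subn2 subn1.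
apply: eq_existsb => -[a b] /=; rewrite !xpair_eqE; congr (_ && _).
apply: andb_id2l => _; apply: andb_id2l => /eqP/invg_sqr1 b_inv.
by rewrite conjgE b_inv mulgA.
Qed.

Lemma Grp_quaternion_mul n : (n > 2)%N ->
  'Q_(2 ^ n) \isog Grp (a : b : a ^+ (2 ^ (n - 1))%N,
                                b ^+ 2 = a ^+ (2 ^ (n - 2))%N,
                                b^-1 * a * b = a^-1).
Proof.
move=> n_gt2 rT K; rewrite Grp_quaternion // subn1 subn2.
by apply: eq_existsb => -[a b] /=; rewrite conjgE mulgA.
Qed.

Lemma Grp_modular_group_mul p n : prime p -> (n > 2)%N ->
  'Mod_(p ^ n) \isog Grp (a : b : a ^+ (p ^ (n - 1))%N, b ^+ p,
                                  b^-1 * a * b = a ^+ (1 + p ^ (n - 2))%N).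
Proof.
move=> p_pr n_gt2 rT K; rewrite Grp_modular_group // subn1 subn2.
by apply: eq_existsb => -[a b] /=; rewrite conjgE mulgA.
Qed.

(** * Noncyclic p-groups with a cyclic subgroup of index p *)

Definition near_cyclic_pgroup (p : nat) (gT : finGroupType) (G : {group gT}) :=
  [/\ p.-group G, ~~ cyclic G
    & exists X : {group gT}, [/\ X \subset G, cyclic X & #|G : X| = p]].

Lemma extremal_generators_near_cyclic (gT : finGroupType) (G : {group gT})
    p n x y :
  prime p -> extremal_generators G p n (x, y) -> ~~ abelian G ->
  near_cyclic_pgroup p G.
Proof.
move=> p_pr genG nab.
have [pG maxX _ _ _] := extremal_generators_facts p_pr genG.
split=> //; first by apply: contra nab; apply: cyclic_abelian.
exists <[x]>%G; split; rewrite ?cycle_cyclic ?(p_maximal_index pG) //.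
exact: (proper_sub (maxgroupp maxX)).
Qed.

(** The dihedral, quaternion and semidihedral groups of order [2 ^ n] have
    maximal class [n.-1]. *)
Lemma nil_class_nonabelian (gT : finGroupType) (G : {group gT}) n :
  (2 < n)%N -> nil_class G = n.-1 -> ~~ abelian G.
Proof. by case: n => [|[|[|n]]] // _; rewrite -nil_class1 => ->. Qed.

Lemma dihedral_near_cyclic (gT : finGroupType) (G : {group gT}) n :
  (2 < n)%N -> G \isog 'D_(2 ^ n) -> near_cyclic_pgroup 2 G.
Proof.
move=> n_gt2 isoG.
have [[x y] genG _] := generators_2dihedral (ltnW n_gt2) isoG.
have [_ [_ _ _ /(nil_class_nonabelian n_gt2) nab] _ _ _] :=
  dihedral2_structure (ltnW n_gt2) genG isoG.
exact: (extremal_generators_near_cyclic _ genG nab).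
Qed.

Lemma quaternion_near_cyclic (gT : finGroupType) (G : {group gT}) n :
  (2 < n)%N -> G \isog 'Q_(2 ^ n) -> near_cyclic_pgroup 2 G.
Proof.
move=> n_gt2 isoG.
have [[x y] genG _] := generators_quaternion n_gt2 isoG.
have [_ [_ _ _ /(nil_class_nonabelian n_gt2) nab] _ _ _] :=
  quaternion_structure n_gt2 genG isoG.
exact: extremal_generators_near_cyclic _ genG nab.
Qed.

Lemma semidihedral_near_cyclic (gT : finGroupType) (G : {group gT}) n :
  (3 < n)%N -> G \isog 'SD_(2 ^ n) -> near_cyclic_pgroup 2 G.
Proof.
move=> n_gt3 isoG.
have [[x y] genG [oy _]] := generators_semidihedral n_gt3 isoG.
have [_ [_ _ _ /(nil_class_nonabelian (ltnW n_gt3)) nab] _ _ _] :=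
  semidihedral_structure n_gt3 genG isoG oy.
exact: extremal_generators_near_cyclic _ genG nab.
Qed.

Lemma modular_near_cyclic (gT : finGroupType) (G : {group gT}) p n :
  prime p -> (2 < n)%N -> G \isog 'Mod_(p ^ n) -> near_cyclic_pgroup p G.
Proof.
move=> p_pr n_gt2 isoG.
have [[x y] genG modG] := generators_modular_group p_pr n_gt2 isoG.
have [[_ nab _] _ _ _ _] := modular_group_structure p_pr n_gt2 genG isoG modG.
exact: extremal_generators_near_cyclic _ genG nab.
Qed.

Lemma isog_ZpE (gT : finGroupType) (G : {group gT}) n : (0 < n)%N ->
  (G \isog Zp n) = cyclic G && (#|G| == n).
Proof.
move=> n_gt0; have cycZ: cyclic (Zp n).
  by rewrite /Zp; case: ifP; rewrite ?cyclic1 // Zp_cycle cycle_cyclic.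
by rewrite isog_sym (isog_cyclic_card _ cycZ) card_Zp.
Qed.

Lemma isog_near_cyclic (gT rT : finGroupType) (G : {group gT})
    (K : {group rT}) p :
  K \isog G -> near_cyclic_pgroup p K -> near_cyclic_pgroup p G.
Proof.
move=> isoKG [pK ncK [X [sXK cycX iXK]]].
split; first by rewrite -(isog_pgroup p isoKG).
  by rewrite -(isog_cyclic isoKG).
have [f injf <-] := isogP isoKG.
exists (f @* X)%G; split; first exact: morphimS.
  exact: morphim_cyclic.
by rewrite index_injm.
Qed.

(** As [G] is not cyclic its exponent is less than [#|G|], hence equal to the
    order of the cyclic subgroup [X] of index [p]; a cyclic subgroup whose order
    is the exponent of an abelian group is a direct factor. *)
Lemma abelian_near_cyclic_isog (gT : finGroupType) (G : {group gT}) p :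
  prime p -> abelian G -> near_cyclic_pgroup p G ->
  exists2 n, (2 <= n)%N & G \isog setX (Zp (p ^ (n - 1))%N) (Zp p).
Proof.
move=> p_pr cGG [pG ncG [X [sXG cycX iXG]]].
have [x defX] := cyclicP cycX.
have [r oX] := p_natP (pgroupS sXG pG).
have oG: #|G| = (p ^ r.+1)%N by rewrite -(Lagrange sXG) iXG oX expnSr.
have r_gt0: (0 < r)%N.
  rewrite lt0n; apply: contraNneq ncG => r0.
  by rewrite prime_cyclic // oG r0 expn1.
have expG: #[x] = exponent G.
  have [y Gy expGy] := exponent_witness (abelian_nil cGG).
  have [s oy] := p_natP (mem_p_elt pG Gy).
  have ox: #[x] = (p ^ r)%N by rewrite -oX defX.
  have: (p ^ r %| p ^ s)%N.
    by rewrite -ox -oy -expGy dvdn_exponent // -cycle_subG -defX.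
  rewrite expGy ox oy dvdn_Pexp2l ?prime_gt1 // leq_eqVlt.
  case/predU1P=> [-> // | lt_rs]; case/negP: ncG; apply/cyclicP; exists y.
  apply/eqP; rewrite eq_sym eqEcard cycle_subG Gy -orderE oG oy /=.
  by rewrite leq_exp2l ?prime_gt1.
have Gx: x \in G by rewrite -cycle_subG -defX.
have /splitsP[Y /complP[tiXY defG]] := abelian_splits Gx expG cGG.
have sYG: Y \subset G by rewrite -defG mulG_subr.
have oY: #|Y| = p.
  apply/eqP; rewrite -(eqn_pmul2l (cardG_gt0 X)) -[in eqbRHS]iXG Lagrange //.
  by rewrite -defG defX TI_cardMg.
have dG : <[x]> \x Y = G.
  by rewrite dprodE // (sub_abelian_cent2 cGG) // cycle_subG.
have q_gt0 k: (0 < p ^ k)%N by rewrite expn_gt0 prime_gt0.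
exists r.+1 => //; rewrite subn1 /=.
apply: isog_dprod dG (setX_dprod _ _) _ _.
  apply: isog_trans (isog_setX1 _ _).
  by rewrite isog_ZpE ?q_gt0 // cycle_cyclic -oX defX /=.
apply: isog_trans (isog_set1X _ _).
by rewrite isog_ZpE ?prime_gt0 // prime_cyclic oY /=.
Qed.

Lemma setX_Zp_near_cyclic (gT : finGroupType) (G : {group gT}) p n :
  prime p -> (2 <= n)%N -> G \isog setX (Zp (p ^ (n - 1))%N) (Zp p) ->
  near_cyclic_pgroup p G.
Proof.
move=> p_pr n_ge2; rewrite -(subnK n_ge2) addn2 subn1 /=.
move: (n - 2)%N => m isoG.
have p_gt0 := prime_gt0 p_pr.
set q := (p ^ m.+1)%N in isoG; have q_gt0: (0 < q)%N by rewrite expn_gt0 p_gt0.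
have cycZ k: (0 < k)%N -> cyclic (Zp k).
  move=> k_gt0; have := isog_refl (Zp_group k).
  by rewrite isog_ZpE // => /andP[].
have dK := setX_dprod (Zp_group q) (Zp_group p).
have cycA: cyclic (setX (Zp q) (1 : {set 'Z_p})).
  by rewrite -(isog_cyclic (isog_setX1 _ (Zp_group q))) cycZ.
have cycB: cyclic (setX (1 : {set 'Z_q}) (Zp p)).
  by rewrite -(isog_cyclic (isog_set1X _ (Zp_group p))) cycZ.
have oA: #|setX (Zp q) (1 : {set 'Z_p})| = q.
  by rewrite cardsX cards1 muln1 card_Zp.
have oB: #|setX (1 : {set 'Z_q}) (Zp p)| = p.
  by rewrite cardsX cards1 mul1n card_Zp.
rewrite isog_sym in isoG; apply: isog_near_cyclic isoG _.
split.
- by rewrite /pgroup /= cardsX !card_Zp // pnatM pnatX !pnat_id.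
- rewrite (cyclic_dprod dK) // oA oB coprime_pexpl // /coprime gcdnn.
  by rewrite neq_ltn prime_gt1 ?orbT.
have sAK: setX (Zp q) (1 : {set 'Z_p}) \subset setX (Zp q) (Zp p).
  by rewrite setXS // sub1G.
exists (setX_group (Zp_group q) 1); split=> //.
rewrite -divgS; last exact: sAK.
by rewrite /= oA cardsX !card_Zp // mulKn.
Qed.

(** The nonabelian cases come from the classification of the nonabelian
    [p]-groups with a cyclic maximal subgroup. *)
Lemma near_cyclic_classP (gT : finGroupType) (G : {group gT}) :
  (exists2 p, prime p & near_cyclic_pgroup p G) <->
  [\/ exists p n : nat,
        [/\ prime p, (2 <= n)%N
          & G \isog setX (Zp (p ^ (n - 1))%N) (Zp p)]
    , exists p n : nat,
        [/\ prime p, (3 <= n)%N, (p = 2%N -> (4 <= n)%N)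
          & G \isog 'Mod_(p ^ n)]
    | [\/ exists2 n, (3 <= n)%N & G \isog 'D_(2 ^ n)
        , exists2 n, (3 <= n)%N & G \isog 'Q_(2 ^ n)
        | exists2 n, (4 <= n)%N & G \isog 'SD_(2 ^ n)]].
Proof.
split=> [[p p_pr Gp] | ]; last first.
  case=> [[p [n [p_pr n_ge2 isoG]]] | [p [n [p_pr n_ge3 _ isoG]]] | ].
  - by exists p => //; apply: setX_Zp_near_cyclic isoG.
  - by exists p => //; apply: modular_near_cyclic isoG.
  - case=> [] [n n_gt isoG]; exists 2%N => //.
    + exact: dihedral_near_cyclic isoG.
    + exact: quaternion_near_cyclic isoG.
    exact: semidihedral_near_cyclic isoG.
have [cGG | ncGG] := boolP (abelian G).
  have [n n_ge2 isoG] := abelian_near_cyclic_isog p_pr cGG Gp.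
  by constructor 1; exists p, n.
have [pG _ [X [sXG cycX iXG]]] := Gp.
have := maximal_cycle_extremal pG ncGG cycX sXG iXG.
case/orP=> [/eqP/modular_group_classP[q q_pr [n n_ge isoG]] | /andP[_ ext2G]].
  constructor 2; exists q, n; split=> // [|q2].
    exact: leq_trans (leq_addl _ _) n_ge.
  by rewrite q2 in n_ge.
rewrite /extremal2 /= !inE in ext2G; constructor 3; case/or3P: ext2G => /eqP.
- case/dihedral_classP=> n n_gt1 isoG; constructor 1; exists n => //.
  have [n_gt2 // | n_le2] := ltnP 2 n.
  (* the Klein group ['D_4] counts as dihedral, but it is abelian *)
  case/negP: ncGG; apply: (@card_p2group_abelian _ 2) => //.
  have def_n: n = 2%N by apply/eqP; rewrite eqn_leq n_le2.
  by rewrite (card_isog isoG) card_2dihedral def_n.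
- by case/semidihedral_classP=> n n_gt3 isoG; constructor 3; exists n.
by case/quaternion_classP=> n n_gt2 isoG; constructor 2; exists n.
Qed.

(** * Nilpotent groups whose graph has a universal vertex *)

(** In a [p]-group the condition [~~ (H \subset 'Phi(G))] on a maximal [H]
    only excludes cyclic groups: ['Phi(G) = H] makes ['Phi(G)] of prime index,
    so [G] is cyclic, while in a cyclic [G] the Frattini subgroup contains all
    the proper subgroups. *)
Lemma universal_vertex_pgroupP (gT : finGroupType) (G : {group gT}) :
  (exists2 p, prime p & near_cyclic_pgroup p G) <->
  (exists p : nat, p.-group G /\
    exists H : {group gT}, universal_vertex (deleted_comax_graph G) H).
Proof.
split=> [[p p_pr [pG ncG [X [sXG cycX iXG]]]] | [p [pG [H]]]].
  exists p; split=> //; exists X; apply/(universal_vertexP _ (pgroup_nil pG)).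
  have maxX: maximal X G by apply: p_index_maximal; rewrite ?iXG.
  exists p; split=> //; first exact: pgroupS sXG pG.
  apply: contra ncG => sXPhi; apply: Phi_quotient_cyclic.
  have -> : 'Phi(G) = X by apply/eqP; rewrite eqEsubset sXPhi Phi_sub_max.
  rewrite prime_cyclic // card_quotient ?iXG // normal_norm //.
  exact: p_maximal_normal pG maxX.
have nilG := pgroup_nil pG.
case/(universal_vertexP _ nilG)=> q [q_pr qH cycH maxH nPhiH].
have ntG: G :!=: 1.
  apply: contraNneq nPhiH => G1.
  by rewrite (subset_trans (proper_sub (maxgroupp maxH))) // G1 sub1G.
have [p_pr _ _] := pgroup_pdiv pG ntG.
have prH := maxgroupp maxH.
exists p => //; split=> //.
  apply: contra nPhiH => cycG.
  exact: proper_sub_Phi_cyclic_pgroup pG cycG prH.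
by exists H; rewrite (p_maximal_index pG) ?proper_sub.
Qed.

Lemma card_pcore_pexp_mul (gT : finGroupType) (G : {group gT}) (p q r : nat) :
  nilpotent G -> prime p -> prime q -> p != q -> #|G| = (p ^ r * q)%N ->
  #|'O_p(G)| = (p ^ r)%N /\ #|'O_q(G)| = q.
Proof.
move=> nilG p_pr q_pr neq_pq oG.
have [p_gt0 q_gt0] := (prime_gt0 p_pr, prime_gt0 q_pr).
rewrite !(card_Hall (nilpotent_pcore_Hall _ nilG)) oG !p_part.
rewrite !lognM ?expn_gt0 ?p_gt0 // !lognX !logn_prime // !eqxx.
by rewrite (negPf neq_pq) eq_sym (negPf neq_pq) muln1 muln0 addn0 add0n expn1.
Qed.

(** The Sylow [p]-subgroup is universal: it is not in ['Phi(G)], as otherwise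
    the Sylow [q]-subgroup alone would generate [G]. *)
Lemma universal_vertex_cyclic_pq (gT : finGroupType) (G : {group gT}) p q r :
  prime p -> prime q -> p <> q -> (1 <= r)%N -> cyclic G ->
  #|G| = (p ^ r * q)%N ->
  exists H : {group gT}, universal_vertex (deleted_comax_graph G) H.
Proof.
move=> p_pr q_pr /eqP neq_pq r_gt0 cycG oG.
have nilG := abelian_nil (cyclic_abelian cycG).
have [oP oQ] := card_pcore_pexp_mul nilG p_pr q_pr neq_pq oG.
have sPG := pcore_sub p G.
have sQG := pcore_sub q G.
have defG: 'O_p(G) * 'O_q(G) = G.
  apply/eqP; rewrite eqEcard mul_subG //= coprime_cardMg oP oQ ?oG //.
  by rewrite coprime_pexpl // prime_coprime // dvdn_prime2.
exists 'O_p(G)%G; apply/(universal_vertexP _ nilG); exists p.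
split=> //; first exact: pcore_pgroup.
- exact: cyclicS cycG.
- apply: p_index_maximal => //=.
  by rewrite -divgS //= oP oG mulKn ?expn_gt0 ?prime_gt0.
apply: contraL (r_gt0) => sPPhi; rewrite -leqNgt.
have defQ: 'O_q(G) = G.
  rewrite -[LHS]genGid; apply: Phi_nongen; apply/eqP.
  rewrite eqEsubset join_subG Phi_sub sQG /= -{1}defG.
  by rewrite mul_subG ?joing_subr // (subset_trans sPPhi) ?joing_subl.
have := oG; rewrite -{1}defQ oQ => /eqP.
rewrite -{1}(mul1n q) eqn_pmul2r ?prime_gt0 //.
by rewrite eq_sym -[eqbRHS](expn0 p) eqn_exp2l ?prime_gt1 // => /eqP->.
Qed.

(** The universal vertex [H] is a cyclic [p]-group of prime index [q]. If
    [q = p] then [G] is a [p]-group; otherwise [G] is the direct product of [H]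
    and a Sylow [q]-subgroup of order [q], two cyclic groups of coprime
    orders. *)
Lemma universal_vertex_pgroup_or_cyclic (gT : finGroupType) (G H : {group gT}) :
  nilpotent G -> universal_vertex (deleted_comax_graph G) H ->
  (exists p : nat, p.-group G) \/
  exists p q r, [/\ prime p, prime q, p <> q, (1 <= r)%N
                  & cyclic G /\ #|G| = (p ^ r * q)%N].
Proof.
move=> nilG /(universal_vertexP _ nilG)[p [p_pr pH cycH maxH nPhiH]].
have q_pr := nilpotent_maximal_index nilG maxH.
have sHG := proper_sub (maxgroupp maxH).
have oG := Lagrange sHG; set q := #|G : H| in q_pr oG.
have [eq_pq | neq_pq] := eqVneq p q.
  left; exists p; rewrite /pgroup -oG pnatM -eq_pq pnat_id // andbT; exact: pH.
have [r oH] := p_natP pH.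
have r_gt0: (0 < r)%N.
  rewrite lt0n; apply: contraNneq nPhiH => r0.
  by rewrite (card1_trivg (_ : #|H| = 1%N)) ?sub1G // oH r0.
right; exists p, q, r; split=> //; first exact/eqP.
rewrite -oH oG; split=> //.
have oG_pq: #|G| = (p ^ r * q)%N by rewrite -oG oH.
have [_ oQ] := card_pcore_pexp_mul nilG p_pr q_pr neq_pq oG_pq.
have coHQ: coprime #|H| #|'O_q(G)|.
  by rewrite oH oQ coprime_pexpl // prime_coprime // dvdn_prime2.
have <-: H * 'O_q(G) = G.
  apply/eqP; rewrite eqEcard mul_subG ?pcore_sub //= coprime_cardMg //.
  by rewrite oQ oG.
rewrite cyclicM //; first by rewrite prime_cyclic // oQ.
exact: (sub_nilpotent_cent2 nilG) (pcore_sub _ _) _.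
Qed.

(** Subgroups of coprime orders commute in a nilpotent group, whereas here the
    action is nontrivial. *)
Lemma nilpotent_not_sdprod_Zp_Zq (gT : finGroupType) (G : {group gT}) p q :
  nilpotent G -> prime p -> prime q -> p <> q -> ~ is_sdprod_Zp_Zq p q G.
Proof.
move=> nilG p_pr q_pr /eqP neq_pq [A [B [defG isoA isoB /negP[]]]].
have [_ defAB _ _] := sdprodP defG.
apply: (sub_nilpotent_cent2 nilG); rewrite -?defAB ?mulG_subl ?mulG_subr //.
rewrite (card_isog isoA) (card_isog isoB) !card_Zp ?prime_gt0 //.
by rewrite prime_coprime // dvdn_prime2.
Qed.

(** * The classification *)

Unset Implicit Arguments.

Theorem theorem3p6 (gT : finGroupType) (G : {group gT}) (nilG : nilpotent G) :
  (exists H : {group gT}, universal_vertex (deleted_comax_graph G) H)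
  <->
  [\/ exists p q r : nat,
        [/\ prime p, prime q, p <> q, (1 <= r)%N
          & G \isog Zp (p ^ r * q)%N]
    , exists p q : nat,
        [/\ prime p, prime q, p <> q, (q %| p - 1)%N
          & is_sdprod_Zp_Zq p q G]
    , exists p n : nat,
        [/\ prime p, (2 <= n)%N
          & G \isog setX (Zp (p ^ (n - 1))%N) (Zp p)]
    | [\/ exists p n : nat,
            [/\ prime p, (3 <= n)%N, (p = 2%N -> (4 <= n)%N)
              & G \isog Grp (a : b : a ^+ (p ^ (n - 1))%N, b ^+ p,
                                     b^-1 * a * b = a ^+ (1 + p ^ (n - 2))%N)]
        , exists n : nat,
            (3 <= n)%N /\
            G \isog Grp (a : b : a ^+ (2 ^ (n - 1))%N, b ^+ 2,
                                 b * a * b = a^-1)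
        , exists n : nat,
            (3 <= n)%N /\
            G \isog Grp (a : b : a ^+ (2 ^ (n - 1))%N,
                                 b ^+ 2 = a ^+ (2 ^ (n - 2))%N,
                                 b^-1 * a * b = a^-1)
        | exists n : nat,
            (4 <= n)%N /\
            G \isog Grp (a : b : a ^+ (2 ^ (n - 1))%N, b ^+ 2,
                                 b * a * b = a ^+ (2 ^ (n - 2) - 1)%N)]].
Proof.
split=> [[H univH] | ].
  have [[p pG] | [p [q [r [p_pr q_pr neq_pq r_gt0 [cycG oG]]]]]] :=
    universal_vertex_pgroup_or_cyclic nilG univH.
    have [_ /(_ (ex_intro _ p (conj pG (ex_intro _ H univH))))] :=
      universal_vertex_pgroupP G.
    move/near_cyclic_classP=> [abG | [p1 [n [p_pr n_ge3 n_ge4 isoG]]] | ].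
    - by constructor 3.
    - constructor 4; constructor 1; exists p1, n; split=> //.
      exact/(isoGrp_isog _ (Grp_modular_group_mul p_pr n_ge3)).
    - case=> [] [n n_ge isoG]; constructor 4.
      + constructor 2; exists n; split=> //.
        exact/(isoGrp_isog _ (Grp_2dihedral_mul (ltnW n_ge))).
      + constructor 3; exists n; split=> //.
        exact/(isoGrp_isog _ (Grp_quaternion_mul n_ge)).
      constructor 4; exists n; split=> //.
      exact/(isoGrp_isog _ (Grp_semidihedral_mul n_ge)).
  constructor 1; exists p, q, r; split=> //.
  by rewrite isog_ZpE ?cycG ?oG ?muln_gt0 ?expn_gt0 ?prime_gt0 /=.
have pgroup_case: (exists2 p, prime p & near_cyclic_pgroup p G) ->
    exists H, universal_vertex (deleted_comax_graph G) H.
  by case/universal_vertex_pgroupP=> p [].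
case.
- case=> p [q [r [p_pr q_pr neq_pq r_gt0]]].
  rewrite isog_ZpE ?muln_gt0 ?expn_gt0 ?prime_gt0 //= => /andP[cycG /eqP oG].
  exact: universal_vertex_cyclic_pq p_pr q_pr neq_pq r_gt0 cycG oG.
- case=> p [q [p_pr q_pr neq_pq _]].
  by move/(nilpotent_not_sdprod_Zp_Zq nilG p_pr q_pr neq_pq).
- by move=> abG; apply/pgroup_case/near_cyclic_classP; constructor 1.
move=> presG; apply/pgroup_case/near_cyclic_classP.
case: presG => [[p [n [p_pr n_ge3 n_ge4]]] | [n [n_ge]]
              | [n [n_ge]] | [n [n_ge]]].
- move/(isoGrp_isog _ (Grp_modular_group_mul p_pr n_ge3)) => isoG.
  by constructor 2; exists p, n.
- move/(isoGrp_isog _ (Grp_2dihedral_mul (ltnW n_ge))) => isoG.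
  by constructor 3; constructor 1; exists n.
- move/(isoGrp_isog _ (Grp_quaternion_mul n_ge)) => isoG.
  by constructor 3; constructor 2; exists n.
move/(isoGrp_isog _ (Grp_semidihedral_mul n_ge)) => isoG.
by constructor 3; constructor 3; exists n.
Qed.
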